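(* Let $\mathbf{C}$ be a small category with countably many arrows, $O$ a set of observations and $T$ an inference system. Let $\mathbf{Coalg}_{\mathbf{H}^I}$ be the full subcategory of $\mathbf{Coalg}_{\mathbf{H}}$ containing the $\mathbf{H}$-coalgebras $\alpha:\mathbb{X}\to\mathbf{H}(\mathbb{X})$ that factor as $\alpha=\alpha';\iota_{\mathbb{X}}$ for some $\Gamma(\mathbf{C})$-homomorphism $\alpha':\mathbb{X}\to\mathbf{S}_T(\mathbb{X})$, where $\iota_{\mathbb{X}}:\mathbf{S}_T(\mathbb{X})\to\mathbf{H}(\mathbb{X})$ is the inclusion. Then the class of objects $|\mathbf{Coalg}_{\mathbf{H}^I}|$ is a covariety of $\mathbf{Coalg}_{\mathbf{H}}$, i.e. it is closed under (1) subcoalgebras, (2) homomorphic images, and (3) sums.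
   Context: Composition is written in diagrammatic order: $f;g$ means first $f$, then $g$. $|\mathbf{C}|$ is the set of objects and $\|\mathbf{C}\|$ the set of arrows of $\mathbf{C}$. A $\Gamma(\mathbf{C})$-algebra $\mathbb{X}$ is a family of sets $X=(X_i)_{i\in|\mathbf{C}|}$ with a function $c_{\mathbb{X}}:X_i\to X_j$ for every $c\in\mathbf{C}[i,j]$ such that $(id_i)_{\mathbb{X}}=id_{X_i}$ and $(d;e)_{\mathbb{X}}(x)=e_{\mathbb{X}}(d_{\mathbb{X}}(x))$ (i.e. a functor $\mathbf{C}\to\mathbf{Set}$). Homomorphisms are natural transformations; the category is $\mathbf{Alg}_{\Gamma(\mathbf{C})}$. $\int X=\sum_{i}X_i$. $\mathbf{G}(X)_i$ is the set of (at most) countable subsets of $\sum_{j\in|\mathbf{C}|}\mathbf{C}[i,j]\times O\times\int X$. The endofunctor $\mathbf{H}$ of $\mathbf{Alg}_{\Gamma(\mathbf{C})}$ maps $\mathbb{X}$ to the algebra with carrier $(\mathbf{G}(X)_i)_i$ and, for $d\in\mathbf{C}[i,k]$, $d_{\mathbf{H}(\mathbb{X})}(A)=\{(c_2,o,x)\mid (c_1,o,x)\in A,\ c_1=d;c_2\}$; on arrows $\mathbf{H}(h)(A)=\{(c,o,h(x))\mid(c,o,x)\in A\}$. An $\mathbf{H}$-coalgebra is $\langle\mathbb{X},\alpha:\mathbb{X}\to\mathbf{H}(\mathbb{X})\rangle$; morphisms $\langle\mathbb{X},\alpha\rangle\to\langle\mathbb{Y},\beta\rangle$ are homomorphisms $f$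 with $\alpha;\mathbf{H}(f)=f;\beta$. An inference system $T$ is a set of rules $c\xrightarrow[o']{o}d$ with $c\in\mathbf{C}[i,i']$, $d\in\mathbf{C}[j,j']$, $o,o'\in O$. $\Phi(T)$ is the closure of $T$ together with all identity rules $id_i\xrightarrow[o]{o}id_j$ ($i,j\in|\mathbf{C}|$, $o\in O$) under: $c\xrightarrow[o']{o}c'$ and $d\xrightarrow[o'']{o'}d'$ give $c;d\xrightarrow[o'']{o}c';d'$ whenever $c;d$ and $c';d'$ are defined. For $d\in\mathbf{C}[i,k]$, $c_1$ of source $i$ and $c_2$ of source $k$, write $(c_1,o_1,q_1)\vdash^{d}_{T,\mathbb{X}}(c_2,o_2,q_2)$ iff there are $e,e'\in\|\mathbf{C}\|$ with $c_1;e=d;c_2$, $e\xrightarrow[o_2]{o_1}e'\in\Phi(T)$ and $e'_{\mathbb{X}}(q_1)=q_2$. Write $\vdash_{T,\mathbb{X}}$ for $\vdash^{id}_{T,\mathbb{X}}$. $A\in\mathbf{G}(X)_i$ is saturated if closed under $\vdash_{T,\mathbb{X}}$. The endofunctor $\mathbf{S}_T$ maps $\mathbb{X}$ to the algebra whose carrier of sort $i$ is the set of saturated sets in $\mathbf{G}(X)_i$, with $d_{\mathbf{S}_T(\mathbb{X})}(A)=\{t_2\mid \exists t_1\in A,\ t_1\vdash^{d}_{T,\mathbb{X}}t_2\}$; on arrows it acts as $\mathbf{H}$. $\langle\mathbb{X},\alpha\rangle$ is a subcoalgebra of $\langle\mathbb{Y},\beta\rangle$ if there is a coalgebra morphism between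 them all of whose components (one per sort) are injective. For a coalgebra morphism $h:\langle\mathbb{X},\alpha\rangle\to\langle\mathbb{Y},\beta\rangle$, factor $h=e;m$ in $\mathbf{Alg}_{\Gamma(\mathbf{C})}$ with $e:\mathbb{X}\to\mathbb{I}$ componentwise surjective and $m:\mathbb{I}\to\mathbb{Y}$ componentwise injective; there is a unique $\gamma:\mathbb{I}\to\mathbf{H}(\mathbb{I})$ making $e$ and $m$ coalgebra morphisms, and $\langle\mathbb{I},\gamma\rangle$ is the homomorphic image of $\langle\mathbb{X},\alpha\rangle$ through $h$. Sums are coproducts in $\mathbf{Coalg}_{\mathbf{H}}$. *)

(* Defs.v *)
From mathcomp Require Import all_boot.
From mathcomp Require Import boolp classical_sets functions cardinality.

Set Implicit Arguments.
Unset Strict Implicit.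
Unset Printing Implicit Defensive.

Local Open Scope classical_set_scope.
#[local] Obligation Tactic := idtac.

Lemma existT_inj (I : Type) (P : I -> Type) (i : I) (x y : P i) :
  existT P i x = existT P i y -> x = y.
Proof.
move=> E; have := projT2_eq E.
by rewrite (Prop_irrelevance (projT1_eq E) erefl).
Qed.

Lemma sval_inj (T : Type) (P : T -> Prop) (x y : {x | P x}) :
  sval x = sval y -> x = y.
Proof.
case: x y => [x px] [y py] /= xy; subst y.
by rewrite (Prop_irrelevance px py).
Qed.

Record smallCat := SmallCat {
  obj :> Type;
  hom : obj -> obj -> Type;
  idm : forall i, hom i i;
  comp : forall i j k, hom i j -> hom j k -> hom i k;
  comp1m : forall i j (f : hom i j), comp (idm i) f = f;
  compm1 : forall i j (f : hom i j), comp f (idm j) = f;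
  compmA : forall i j k l (f : hom i j) (g : hom j k) (h : hom k l),
    comp f (comp g h) = comp (comp f g) h
}.

Arguments hom {s} i j.
Arguments idm {s} i.
Arguments comp {s i j k} f g.

(* Diagrammatic order: first f, then g. *)
Notation "f ;; g" := (comp f g) (at level 50, left associativity).

Definition arrow (C : smallCat) : Type := {i : C & {j : C & hom i j}}.

Record countableCat := CountableCat {
  cat_of :> smallCat;
  countable_arrows : countable [set: arrow cat_of]
}.

Record alg (C : smallCat) := Alg {
  carrier :> C -> Type;
  act : forall i j, hom i j -> carrier i -> carrier j;
  act_id : forall i (x : carrier i), act (idm i) x = x;
  act_comp : forall i j k (d : hom i j) (e : hom j k) (x : carrier i),
    act (d ;; e) x = act e (act d x)
}.

Arguments act {C} a {i j} d x.

Record algHom (C : smallCat) (X Y : alg C) := AlgHom {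
  hom_fun :> forall i, X i -> Y i;
  hom_nat : forall i j (d : hom i j) (x : X i),
    hom_fun (act X d x) = act Y d (hom_fun x)
}.

Arguments hom_fun {C X Y} a i x.

Lemma algHom_ext (C : smallCat) (X Y : alg C) (f g : algHom X Y) :
  (forall i x, f i x = g i x) -> f = g.
Proof.
case: f g => [f fn] [g gn] /= fg.
have {}fg : f = g by apply: functional_extensionality_dep => i; apply/funext.
by case: _ / fg in gn *; rewrite (Prop_irrelevance fn gn).
Qed.

Program Definition algComp (C : smallCat) (X Y Z : alg C)
    (f : algHom X Y) (g : algHom Y Z) : algHom X Z :=
  {| hom_fun := fun i x => g i (f i x) |}.
Next Obligation. by move=> C X Y Z f g i j d x /=; rewrite !hom_nat. Qed.

Definition injectiveHom (C : smallCat) (X Y : alg C) (f : algHom X Y) : Prop :=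
  forall i, injective (f i).

Definition surjectiveHom (C : smallCat) (X Y : alg C) (f : algHom X Y) : Prop :=
  forall i (y : Y i), exists x, f i x = y.

Definition elements (C : smallCat) (X : C -> Type) : Type := {i : C & X i}.

Definition triple (C : smallCat) (O : Type) (X : C -> Type) (i : C) : Type :=
  {j : C & (hom i j * O * elements X)%type}.

Definition mkTriple (C : smallCat) (O : Type) (X : C -> Type) (i j : C)
    (c : hom i j) (o : O) (x : elements X) : triple O X i :=
  existT (fun j => (hom i j * O * elements X)%type) j (c, o, x).

Definition precomp (C : smallCat) (O : Type) (X : C -> Type) (i k : C)
    (d : hom i k) (t : triple O X k) : triple O X i :=
  let: existT _ (c, o, x) := t in mkTriple (d ;; c) o x.

Definition elements_map (C : smallCat) (X Y : C -> Type)
    (h : forall i, X i -> Y i) (x : elements X) : elements Y :=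
  existT Y (projT1 x) (h _ (projT2 x)).

Definition triple_map (C : smallCat) (O : Type) (X Y : C -> Type)
    (h : forall i, X i -> Y i) (i : C) (t : triple O X i) : triple O Y i :=
  let: existT _ (c, o, x) := t in mkTriple c o (elements_map h x).

Arguments triple_map {C O X Y} h {i} t.

Definition Gset (C : smallCat) (O : Type) (X : C -> Type) (i : C) : Type :=
  {A : set (triple O X i) | countable A}.

Lemma Gset_ext (C : smallCat) (O : Type) (X : C -> Type) (i : C)
    (A B : Gset O X i) : val A = val B -> A = B.
Proof. exact: val_inj. Qed.

Lemma countable_precomp (C : countableCat) (O : Type) (X : C -> Type) (i k : C)
    (d : hom i k) (A : set (triple O X i)) :
  countable A -> countable (precomp d @^-1` A).
Proof.
move=> /countable_injP[f finj].
have /countable_injP[g ginj] := countable_arrows C.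
pose ar (t : triple O X k) : arrow C :=
  let: existT j (c, _, _) := t in existT _ k (existT _ j c).
apply/countable_injP; exists (fun t => pickle (g (ar t), f (precomp d t))).
move=> t t'; rewrite !inE => At At' /(pcan_inj pickleK)[eg ef].
have {}eg : ar t = ar t' by apply: ginj => //; rewrite inE.
have {ef At At'} : precomp d t = precomp d t' by apply: finj; rewrite ?inE.
case: t t' eg => [j [[c o] x]] [j' [[c' o'] x']] /= eg ef.
have {eg} E := existT_inj eg.
have Eo : o = o' := congr1 (fun t => (projT2 t).1.2) ef.
have Ex : x = x' := congr1 (fun t => (projT2 t).2) ef.
pose F (u : {j : C & hom k j}) : triple O X k := mkTriple (projT2 u) o x.
by rewrite -Eo -Ex; exact: (congr1 F E).
Qed.

(* In the comprehension over (c1, o, x) in A with c1 = d;c2, the triple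
   (c1, o, x) is precomp d (c2, o, x); hence a preimage. *)
Definition H_act (C : countableCat) (O : Type) (X : C -> Type) (i k : C)
    (d : hom i k) (A : Gset O X i) : Gset O X k :=
  exist _ (precomp d @^-1` val A) (countable_precomp d (valP A)).

Program Definition Halg (C : countableCat) (O : Type) (X : alg C) : alg C :=
  {| carrier := Gset O X; act := @H_act C O X |}.
Next Obligation.
move=> C O X i A; apply/Gset_ext/seteqP.
by split=> -[j [[c o] x]] /=; rewrite comp1m.
Qed.
Next Obligation.
move=> C O X i j k d e A; apply/Gset_ext/seteqP.
by split=> -[l [[c o] x]] /=; rewrite compmA.
Qed.

Lemma countable_image (T U : Type) (f : T -> U) (A : set T) :
  countable A -> countable (f @` A).
Proof. exact/sub_countable/card_image_le. Qed.

Definition H_fun (C : countableCat) (O : Type) (X Y : C -> Type)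
    (h : forall i, X i -> Y i) (i : C) (A : Gset O X i) : Gset O Y i :=
  exist _ (triple_map h @` val A) (countable_image (triple_map h) (valP A)).

Program Definition H_map (C : countableCat) (O : Type) (X Y : alg C)
    (h : algHom X Y) : algHom (Halg O X) (Halg O Y) :=
  {| hom_fun := H_fun h |}.
Next Obligation.
move=> C O X Y h i k d A; apply/Gset_ext/seteqP; split => /=.
- move=> _ [[j [[c o] x]] /= At <-].
  by exists (precomp d (mkTriple c o x)).
- move=> [j [[c o] y]] /= [[j' [[c' o'] x]] /= At e].
  have ej : j' = j := congr1 (@projT1 _ _) e.
  subst j'; have [ec eo ey] := existT_inj e; subst c' o' y.
  by exists (mkTriple c o x).
Qed.

Record coalg (C : countableCat) (O : Type) := Coalg {
  coalg_alg :> alg C;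
  coalg_str : algHom coalg_alg (Halg O coalg_alg)
}.

Arguments coalg_str {C O} c.

Record coalgHom (C : countableCat) (O : Type) (X Y : coalg C O) := CoalgHom {
  coalgHom_hom :> algHom X Y;
  coalgHomP : algComp (coalg_str X) (H_map O coalgHom_hom) =
              algComp coalgHom_hom (coalg_str Y)
}.

Lemma coalgHom_ext (C : countableCat) (O : Type) (X Y : coalg C O)
    (f g : coalgHom X Y) : (forall i x, f i x = g i x) -> f = g.
Proof.
case: f g => [f fP] [g gP] /= /algHom_ext fg.
by case: _ / fg in gP *; rewrite (Prop_irrelevance fP gP).
Qed.

Lemma triple_map_comp (C : smallCat) (O : Type) (X Y Z : alg C)
    (f : algHom X Y) (g : algHom Y Z) (i : C) (t : triple O X i) :
  triple_map (algComp f g) t = triple_map g (triple_map f t).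
Proof. by case: t => [j [[c o] x]]. Qed.

Lemma H_map_comp (C : countableCat) (O : Type) (X Y Z : alg C)
    (f : algHom X Y) (g : algHom Y Z) :
  H_map O (algComp f g) = algComp (H_map O f) (H_map O g).
Proof.
apply: algHom_ext => i A; apply: Gset_ext => /=.
by rewrite image_comp; apply: eq_imagel => t _; exact: triple_map_comp.
Qed.

Lemma coalgHomE (C : countableCat) (O : Type) (X Y : coalg C O)
    (f : coalgHom X Y) (i : C) (x : X i) :
  H_map O f i (coalg_str X i x) = coalg_str Y i (f i x).
Proof.
exact: (congr1 (fun h : algHom X (Halg O Y) => h i x) (coalgHomP f)).
Qed.

Program Definition coalgComp (C : countableCat) (O : Type) (X Y Z : coalg C O)
    (f : coalgHom X Y) (g : coalgHom Y Z) : coalgHom X Z :=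
  {| coalgHom_hom := algComp f g |}.
Next Obligation.
move=> C O X Y Z f g; apply: algHom_ext => i x.
by rewrite H_map_comp /= -coalgHomE -coalgHomE.
Qed.

(* [T _ _ _ _ c o o' d]: the rule from c to d with trigger o (written above
   the arrow) and effect o' (written below it). *)
Definition infSystem (C : smallCat) (O : Type) : Type :=
  forall i i' j j' : C, hom i i' -> O -> O -> hom j j' -> Prop.

Inductive Phi (C : smallCat) (O : Type) (T : infSystem C O) : infSystem C O :=
| Phi_rule i i' j j' (c : hom i i') o o' (d : hom j j') :
    T i i' j j' c o o' d -> Phi T c o o' d
| Phi_id i j o : Phi T (idm i) o o (idm j)
| Phi_comp i1 i2 i3 j1 j2 j3 (c : hom i1 i2) (d : hom i2 i3)
    (c' : hom j1 j2) (d' : hom j2 j3) o o' o'' :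
    Phi T c o o' c' -> Phi T d o' o'' d' -> Phi T (c ;; d) o o'' (c' ;; d').

Definition entails (C : smallCat) (O : Type) (T : infSystem C O) (X : alg C)
    (i k : C) (d : hom i k) (t1 : triple O X i) (t2 : triple O X k) : Prop :=
  let: existT j1 (c1, o1, existT p1 x1) := t1 in
  let: existT j2 (c2, o2, existT p2 x2) := t2 in
  exists (e : hom j1 j2) (e' : hom p1 p2),
    [/\ c1 ;; e = d ;; c2, Phi T e o1 o2 e' & act X e' x1 = x2].

Definition saturated (C : smallCat) (O : Type) (T : infSystem C O) (X : alg C)
    (i : C) (A : Gset O X i) : Prop :=
  forall t1 t2, val A t1 -> entails T (idm i) t1 t2 -> val A t2.

Definition satSet (C : smallCat) (O : Type) (T : infSystem C O) (X : alg C)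
    (i : C) : Type :=
  {A : Gset O X i | saturated T A}.

Definition S_set (C : smallCat) (O : Type) (T : infSystem C O) (X : alg C)
    (i k : C) (d : hom i k) (A : set (triple O X i)) : set (triple O X k) :=
  [set t2 | exists t1, A t1 /\ entails T d t1 t2].

(* On saturated sets the actions of S_T and H agree; in particular S_T yields
   countable sets even when O and T are uncountable. *)
Lemma S_setE (C : countableCat) (O : Type) (T : infSystem C O) (X : alg C)
    (i k : C) (d : hom i k) (A : Gset O X i) :
  saturated T A -> S_set T d (val A) = val (H_act d A).
Proof.
move=> satA; apply/seteqP; split=> /=.
- move=> t2 [t1 [At1 t12]]; apply: satA At1 _.
  case: t1 t2 t12 => [j1 [[c1 o1] [p1 x1]]] [j2 [[c2 o2] [p2 x2]]] /=.
  by move=> [e [e' [ce pe ee]]]; exists e, e'; rewrite comp1m.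
- move=> t2 At2; exists (precomp d t2); split=> //.
  case: t2 {At2} => [j2 [[c2 o2] [p2 x2]]] /=; exists (idm j2), (idm p2).
  by split; [exact: compm1 | exact: Phi_id | exact: act_id].
Qed.

Lemma S_countable (C : countableCat) (O : Type) (T : infSystem C O) (X : alg C)
    (i k : C) (d : hom i k) (A : satSet T X i) :
  countable (S_set T d (val (sval A))).
Proof. by case: A => A /= /S_setE ->; exact: valP (H_act d A). Qed.

Lemma S_saturated (C : countableCat) (O : Type) (T : infSystem C O) (X : alg C)
    (i k : C) (d : hom i k) (A : satSet T X i) :
  saturated T (exist (fun B => countable B) _ (S_countable d A) : Gset O X k).
Proof.
case: A => A satA /= t1 t2; rewrite /= S_setE // => At1 t12.
apply: satA At1 _.
case: t1 t2 t12 => [j1 [[c1 o1] [p1 x1]]] [j2 [[c2 o2] [p2 x2]]] /=.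
move=> [e [e' [ce pe ee]]]; exists e, e'.
by rewrite comp1m -compmA ce comp1m.
Qed.

Definition S_act (C : countableCat) (O : Type) (T : infSystem C O) (X : alg C)
    (i k : C) (d : hom i k) (A : satSet T X i) : satSet T X k :=
  exist _ (exist _ (S_set T d (val (sval A))) (S_countable d A))
    (@S_saturated C O T X i k d A).

Lemma S_actE (C : countableCat) (O : Type) (T : infSystem C O) (X : alg C)
    (i k : C) (d : hom i k) (A : satSet T X i) :
  sval (S_act d A) = act (Halg O X) d (sval A).
Proof. by case: A => A sA; apply: Gset_ext; exact: S_setE. Qed.

Program Definition Salg (C : countableCat) (O : Type) (T : infSystem C O)
    (X : alg C) : alg C :=
  {| carrier := satSet T X; act := @S_act C O T X |}.
Next Obligation.
by move=> C O T X i A; apply: sval_inj; rewrite S_actE act_id.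
Qed.
Next Obligation.
by move=> C O T X i j k d e A; apply: sval_inj; rewrite !S_actE act_comp.
Qed.

Program Definition iota_hom (C : countableCat) (O : Type) (T : infSystem C O)
    (X : alg C) : algHom (Salg T X) (Halg O X) :=
  {| hom_fun := fun i (A : satSet T X i) => sval A |}.
Next Obligation. by move=> C O T X i j d A; exact: S_actE. Qed.

(* The objects of the full subcategory Coalg_{H^I}. *)
Definition CoalgHI (C : countableCat) (O : Type) (T : infSystem C O)
    (X : coalg C O) : Prop :=
  exists alpha' : algHom X (Salg T X), coalg_str X = algComp alpha' (iota_hom T X).

Definition subcoalgebra (C : countableCat) (O : Type) (X Y : coalg C O) : Prop :=
  exists m : coalgHom X Y, injectiveHom m.

Definition homImage (C : countableCat) (O : Type) (X Y : coalg C O)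
    (h : coalgHom X Y) (I : coalg C O) : Prop :=
  exists (e : coalgHom X I) (m : coalgHom I Y),
    [/\ surjectiveHom e, injectiveHom m & coalgComp e m = h].

Definition isSum (C : countableCat) (O : Type) (K : Type) (F : K -> coalg C O)
    (U : coalg C O) (inj : forall k, coalgHom (F k) U) : Prop :=
  forall (Y : coalg C O) (f : forall k, coalgHom (F k) Y),
    exists! g : coalgHom U Y, forall k, coalgComp (inj k) g = f k.

(* isSum is the universal property, so closure under sums is about every
   coproduct; sumCoalgP and imageCoalgP below show that sums and homomorphic
   images always exist. *)
Record covariety (C : countableCat) (O : Type) (P : coalg C O -> Prop) : Prop :=
  Covariety {
    closed_subcoalgebra : forall X Y, subcoalgebra X Y -> P Y -> P X;
    closed_homImage : forall X Y (h : coalgHom X Y) I, homImage h I -> P X -> P I;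
    closed_sum : forall (K : Type) (F : K -> coalg C O) U
      (inj : forall k, coalgHom (F k) U),
      isSum inj -> (forall k, P (F k)) -> P U
  }.

Section Sum.
Context (C : countableCat) (O : Type) (K : Type) (F : K -> coalg C O).

Program Definition sumAlg : alg C :=
  {| carrier := fun i => {k : K & F k i};
     act := fun i j d x => existT (fun k => F k j) (projT1 x)
                             (act (F (projT1 x)) d (projT2 x)) |}.
Next Obligation. by move=> i [k x] /=; rewrite act_id. Qed.
Next Obligation. by move=> i j k d e [l x] /=; rewrite act_comp. Qed.

Program Definition sumAlg_in (k : K) : algHom (F k) sumAlg :=
  {| hom_fun := fun i x => existT (fun k => F k i) k x |}.
Next Obligation. by []. Qed.

Program Definition sumCoalg : coalg C O :=
  {| coalg_alg := sumAlg;
     coalg_str := {| hom_fun := fun i (x : sumAlg i) =>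
       H_map O (sumAlg_in (projT1 x)) i
         (coalg_str (F (projT1 x)) i (projT2 x)) |} |}.
Next Obligation. by move=> i j d [k x]; rewrite -hom_nat -hom_nat. Qed.

Program Definition sumCoalg_in (k : K) : coalgHom (F k) sumCoalg :=
  {| coalgHom_hom := sumAlg_in k |}.
Next Obligation. by move=> k; apply: algHom_ext. Qed.

Lemma sumCoalgP : isSum sumCoalg_in.
Proof.
move=> Y f.
have gnat i j (d : hom i j) (x : sumAlg i) :
    f (projT1 (act sumAlg d x)) j (projT2 (act sumAlg d x)) =
    act Y d (f (projT1 x) i (projT2 x)) by exact: hom_nat.
pose g0 : algHom sumCoalg Y :=
  @AlgHom C sumAlg Y (fun i x => f (projT1 x) i (projT2 x)) gnat.
have g0in k : algComp (sumAlg_in k) g0 = f k by apply: algHom_ext.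
have g0P : algComp (coalg_str sumCoalg) (H_map O g0) =
           algComp g0 (coalg_str Y).
  apply: algHom_ext => i [k x].
  rewrite /= -(coalgHomE (f k)) -g0in H_map_comp //.
exists (CoalgHom g0P); split=> [k|g gf]; first exact: coalgHom_ext.
by apply: coalgHom_ext => i [k x]; rewrite /= -gf.
Qed.

End Sum.

Section Image.
Context (C : countableCat) (O : Type) (X Y : coalg C O) (h : coalgHom X Y).

Program Definition imageAlg : alg C :=
  {| carrier := fun i => {y : Y i | exists x, h i x = y};
     act := fun i j d y => exist _ (act Y d (sval y)) _ |}.
Next Obligation.
by move=> i j d [y [x xy]]; exists (act X d x); rewrite hom_nat xy.
Qed.
Next Obligation. by move=> i y; apply: sval_inj; exact: act_id. Qed.
Next Obligation. by move=> i j k d e y; apply: sval_inj; exact: act_comp. Qed.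

Program Definition image_incl : algHom imageAlg Y :=
  {| hom_fun := fun i y => sval y |}.
Next Obligation. by []. Qed.

Program Definition image_corestr : algHom X imageAlg :=
  {| hom_fun := fun i x => exist _ (h i x) (ex_intro _ x erefl) |}.
Next Obligation. by move=> i j d x; apply: sval_inj; exact: hom_nat. Qed.

Lemma triple_incl_inj i :
  injective (triple_map image_incl : triple O imageAlg i -> triple O Y i).
Proof.
move=> [j [[c o] [p x]]] [j' [[c' o'] [p' x']]] /= e.
have ej : j = j' := congr1 (@projT1 _ _) e; subst j'.
have [ec eo ep ex] := existT_inj e; subst c' o' p'.
by have /sval_inj -> := existT_inj ex.
Qed.

Lemma countable_preimage (i : C) (A : set (triple O Y i)) : countable A ->
  countable (triple_map image_incl @^-1` A : set (triple O imageAlg i)).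
Proof.
move=> /countable_injP[f finj]; apply/countable_injP.
exists (fun t => f (triple_map image_incl t)) => t t'; rewrite !inE => At At' e.
by apply: triple_incl_inj; apply: finj; rewrite ?inE.
Qed.

Program Definition imageCoalg : coalg C O :=
  {| coalg_alg := imageAlg;
     coalg_str := {| hom_fun := fun i (y : imageAlg i) =>
       exist _ _ (countable_preimage (valP (coalg_str Y i (sval y)))) |} |}.
Next Obligation.
move=> i j d y; apply: Gset_ext => /=; rewrite hom_nat.
by apply/seteqP; split=> -[k [[c o] x]].
Qed.

Lemma triple_map_image i (t : triple O X i) :
  triple_map image_incl (triple_map image_corestr t) = triple_map h t.
Proof. by case: t => [j [[c o] x]]. Qed.

Lemma strE i (x : X i) :
  val (coalg_str Y i (h i x)) = triple_map h @` val (coalg_str X i x).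
Proof. by rewrite -coalgHomE. Qed.

Program Definition imageCoalg_incl : coalgHom imageCoalg Y :=
  {| coalgHom_hom := image_incl |}.
Next Obligation.
apply: algHom_ext => i [y [x xy]]; apply: Gset_ext => /=.
apply/seteqP; split=> [_ [t At <-] //|t]; rewrite -xy strE => -[t' At' <-].
exists (triple_map image_corestr t'); last exact: triple_map_image.
by rewrite /preimage /= triple_map_image; exists t'.
Qed.

Program Definition imageCoalg_corestr : coalgHom X imageCoalg :=
  {| coalgHom_hom := image_corestr |}.
Next Obligation.
apply: algHom_ext => i x; apply: Gset_ext => /=.
apply/seteqP; split=> [_ [t At <-]|t]; rewrite /= strE.
  by exists t => //; rewrite triple_map_image.
move=> [t' At' e]; exists t' => //; apply: triple_incl_inj.
by rewrite triple_map_image.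
Qed.

Lemma imageCoalgP : homImage h imageCoalg.
Proof.
exists imageCoalg_corestr, imageCoalg_incl; split.
- by move=> i [y [x xy]]; exists x; apply: sval_inj.
- by move=> i x y; exact: sval_inj.
- exact: coalgHom_ext.
Qed.

End Image.

(* Main.v *)
From mathcomp Require Import all_boot.
From mathcomp Require Import classical_sets.
Require Import Defs.

Set Implicit Arguments.
Unset Strict Implicit.
Unset Printing Implicit Defensive.

Local Open Scope classical_set_scope.

(** A coalgebra lies in Coalg_{H^I} iff its structure map takes only saturated
    values. For a homomorphism [h], the direct image under [h] preserves
    saturation, and reflects it when [h] is injective. The former gives closure
    under homomorphic images and under canonical sums, the latter closure under
    subcoalgebras; an arbitrary sum embeds into the canonical one. *)

Section Saturation.
Context (C : countableCat) (O : Type) (T : infSystem C O).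

(** The corestriction of the structure map to saturated sets is natural because the actions of
    [Salg T X] and [Halg O X] agree on such sets ([S_actE]). *)
Lemma CoalgHIP (X : coalg C O) :
  CoalgHI T X <-> forall i (x : X i), saturated T (coalg_str X i x).
Proof.
split=> [[a aE] i x|sat]; first by rewrite aE; exact: svalP (a i x).
pose a i (x : X i) : Salg T X i := exist _ (coalg_str X i x) (sat i x).
have a_nat i j (d : hom i j) (x : X i) :
    a j (act X d x) = act (Salg T X) d (a i x).
  by apply: sval_inj; rewrite S_actE; exact: (hom_nat (coalg_str X)).
by exists (AlgHom a_nat); apply: algHom_ext.
Qed.

Lemma entails_map (X Y : alg C) (h : algHom X Y) i k (d : hom i k)
    (t1 : triple O X i) (t2 : triple O X k) :
  entails T d t1 t2 -> entails T d (triple_map h t1) (triple_map h t2).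
Proof.
case: t1 t2 => [j1 [[c1 o1] [p1 x1]]] [j2 [[c2 o2] [p2 x2]]] /=.
by move=> [e [e' [ce pe <-]]]; exists e, e'; rewrite hom_nat.
Qed.

(** Entailment changes the state only through the action of some [e'], and [h] commutes with this
    action, so the same [e'] can be applied before [h]. *)
Lemma entails_map_lift (X Y : alg C) (h : algHom X Y) i k (d : hom i k)
    (t1 : triple O X i) (t2 : triple O Y k) :
  entails T d (triple_map h t1) t2 ->
  exists2 t, entails T d t1 t & triple_map h t = t2.
Proof.
case: t1 t2 => [j1 [[c1 o1] [p1 x1]]] [j2 [[c2 o2] [p2 x2]]] /=.
move=> [e [e' [ce pe <-]]].
exists (mkTriple c2 o2 (existT X p2 (act X e' x1))); first by exists e, e'.
by rewrite /= /elements_map /= hom_nat.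
Qed.

Lemma triple_map_inj (X Y : alg C) (h : algHom X Y) i :
  injectiveHom h -> injective (triple_map h : triple O X i -> triple O Y i).
Proof.
move=> h_inj [j [[c o] [p x]]] [j' [[c' o'] [p' x']]] /= e.
have ej : j = j' := congr1 (@projT1 _ _) e; subst j'.
have [ec eo ep ex] := existT_inj e; subst c' o' p'.
by have /h_inj -> := existT_inj ex.
Qed.

Lemma saturated_map (X Y : alg C) (h : algHom X Y) i (A : Gset O X i) :
  saturated T A -> saturated T (H_map O h i A : Gset O Y i).
Proof.
move=> satA _ t2 [t1 At1 <-] /entails_map_lift[t t1t <-].
by exists t => //; exact: satA At1 t1t.
Qed.

Lemma saturated_map_inj (X Y : alg C) (h : algHom X Y) i (A : Gset O X i) :
  injectiveHom h -> saturated T (H_map O h i A : Gset O Y i) -> saturated T A.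
Proof.
move=> h_inj sathA t1 t2 At1 /(entails_map h) t12.
(* Saturation of the image only yields some [t] in [A] with the same image as [t2]; injectivity then
   identifies the two. *)
have [|t At] := sathA _ _ _ t12; first by exists t1.
by move=> /(triple_map_inj h_inj) <-.
Qed.

Lemma CoalgHI_sub (X Y : coalg C O) :
  subcoalgebra X Y -> CoalgHI T Y -> CoalgHI T X.
Proof.
move=> [m m_inj] /CoalgHIP satY; apply/CoalgHIP => i x.
by apply: (saturated_map_inj m_inj); rewrite coalgHomE; exact: satY.
Qed.

(** By surjectivity, each value of the structure map of [Y] is the direct image under [e] of a value
    of that of [X]. *)
Lemma CoalgHI_surj (X Y : coalg C O) (e : coalgHom X Y) :
  surjectiveHom e -> CoalgHI T X -> CoalgHI T Y.
Proof.
move=> e_surj /CoalgHIP satX; apply/CoalgHIP => i y.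
have [x <-] := e_surj i y; rewrite -coalgHomE.
by apply: saturated_map; exact: satX.
Qed.

Lemma CoalgHI_sumCoalg (K : Type) (F : K -> coalg C O) :
  (forall k, CoalgHI T (F k)) -> CoalgHI T (sumCoalg F).
Proof.
move=> satF; apply/CoalgHIP => i [k x] /=.
have /CoalgHIP satFk := satF k.
(* On the summand [k], the structure map of the sum is by definition a direct image along the
   injection of [F k]. *)
by apply: (@saturated_map _ (sumAlg F) (sumAlg_in F k)); exact: satFk.
Qed.

End Saturation.

Lemma coalgId_subproof (C : countableCat) (O : Type) (X : coalg C O)
    (f : algHom X X) : (forall i x, f i x = x) ->
  algComp (coalg_str X) (H_map O f) = algComp f (coalg_str X).
Proof.
move=> fE; apply: algHom_ext => i x /=; rewrite fE; apply: Gset_ext => /=.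
rewrite -[RHS]image_id; apply: eq_imagel => -[j [[c o] [p y]]] _ /=.
by rewrite /elements_map /= fE.
Qed.

Definition coalgId (C : countableCat) (O : Type) (X : coalg C O) :
    coalgHom X X :=
  @CoalgHom C O X X (@AlgHom C X X (fun i x => x) (fun i j d x => erefl))
    (@coalgId_subproof C O X (AlgHom (fun i j d x => erefl)) (fun i x => erefl)).

(** The mediating morphism [g] into the canonical sum is a split mono, with the mediating morphism
    [h] back as retraction; hence it is injective in every sort. *)
Lemma isSum_sub (C : countableCat) (O K : Type) (F : K -> coalg C O)
    (U : coalg C O) (inj : forall k, coalgHom (F k) U) :
  isSum inj -> subcoalgebra U (sumCoalg F).
Proof.
move=> sumU.
have [g [g_in _]] := sumU _ (sumCoalg_in F).
have [h [h_in _]] := sumCoalgP inj.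
have [u [_ u_uniq]] := sumU U inj.
have ghK : coalgComp g h = coalgId U.
  (* Both [g] followed by [h] and the identity mediate from [inj] to itself, so both equal [u]. *)
  rewrite -(u_uniq (coalgComp g h)); first last.
    move=> k; apply: coalgHom_ext => i x.
    by rewrite -[RHS](congr1 (fun f : coalgHom _ _ => f i x) (h_in k)) -g_in.
  by apply: u_uniq => k; exact: coalgHom_ext.
exists g => i x y gxy.
have gK z : h i (g i z) = z :=
  congr1 (fun f : coalgHom U U => f i z) ghK.
by rewrite -[x]gK gxy gK.
Qed.

Theorem proposition7p7 (C : countableCat) (O : Type) (T : infSystem C O) :
  covariety (@CoalgHI C O T).
Proof.
split.
- exact: CoalgHI_sub.
- by move=> X Y h I [e [_ [e_surj _ _]]]; exact: CoalgHI_surj e_surj.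
- move=> K F U inj /isSum_sub U_sub satF.
  by apply: CoalgHI_sub U_sub _; exact: CoalgHI_sumCoalg.
Qed.
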